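(* Let $n,m\ge 1$ be integers and let $T:\mathbb{C}^{n\times n}\to\mathbb{C}^{m\times m}$ be a linear map. Then $T$ is completely positive if and only if $\mathcal{J}_2(T)$ is positive semidefinite.
   Context: A matrix is called positive if it is positive semidefinite, and a linear map between matrix algebras is called positive if it maps positive matrices to positive matrices. For an integer $k\ge 1$, $M_k(\mathbb{C}^{n\times n})$ denotes the $k\times k$ matrices with entries in $\mathbb{C}^{n\times n}$, identified with the matrices acting on $\mathbb{C}^k\otimes\mathbb{C}^n$. The map $T_k=\mathrm{id}_k\otimes T: M_k(\mathbb{C}^{n\times n})\to M_k(\mathbb{C}^{m\times m})$ is defined by $T_k\big((a_{ij})_{i,j=1}^k\big)=(T(a_{ij}))_{i,j=1}^k$. $T$ is $k$-positive if $T_k$ is positive; $T$ is completely positive if it is $k$-positive for all integers $k\ge 1$. Let $E_{ij}\in\mathbb{C}^{n\times n}$ ($1\le i,j\le n$) be the matrix with entry $1$ in row $i$, column $j$ and all other entries $0$. The operator $\mathcal{J}_2(T)\in\mathbb{C}^{n\times n}\otimes\mathbb{C}^{m\times m}$, acting on $\mathbb{C}^n\otimes\mathbb{C}^m$, is defined by $\mathcal{J}_2(T)=\sum_{i,j=1}^n E_{ij}\otimes T(E_{ij})$. *)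

(* Defs.v *)
From mathcomp Require Import all_boot all_order all_algebra.
From mathcomp Require Import complex mxtens reals.

Set Implicit Arguments.
Unset Strict Implicit.
Unset Printing Implicit Defensive.

Import Order.TTheory GRing.Theory Num.Theory.
Local Open Scope ring_scope.
Local Open Scope sesquilinear_scope.

Section Definitions.
Variable C : numClosedFieldType.

(* Over C, [0 <= z] means that z is real and nonnegative. *)
Definition psdmx p (A : 'M[C]_p) : Prop :=
  A \is hermsymmx /\ forall v : 'cV[C]_p, 0 <= (v ^t* *m A *m v) 0 0.

Definition positive_map p q (f : 'M[C]_p -> 'M[C]_q) : Prop :=
  forall A : 'M[C]_p, psdmx A -> psdmx (f A).

(* The identification of M_k(C^(n x n)) with the matrices acting on
   C^k (x) C^n: entry ((i, p), (j, q)) of the flattened matrix is entry (p, q)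
   of block (i, j). The pairing of indices is that of the Kronecker product
   [*t]. *)
Definition flatten_mx k n (a : 'M['M[C]_n]_k) : 'M[C]_(k * n) :=
  \matrix_(u, v) a (mxtens_unindex u).1 (mxtens_unindex v).1
                   (mxtens_unindex u).2 (mxtens_unindex v).2.

Definition blocks_mx k n (A : 'M[C]_(k * n)) : 'M['M[C]_n]_k :=
  \matrix_(i, j) \matrix_(p, q)
    A (mxtens_index (i, p)) (mxtens_index (j, q)).

Lemma flatten_mxK k n : cancel (@flatten_mx k n) (@blocks_mx k n).
Proof.
move=> a; apply/matrixP => i j; apply/matrixP => p q.
by rewrite !mxE !mxtens_indexK.
Qed.

Lemma blocks_mxK k n : cancel (@blocks_mx k n) (@flatten_mx k n).
Proof.
by move=> A; apply/matrixP => u v; rewrite !mxE -!surjective_pairing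
  !mxtens_unindexK.
Qed.

Variables n m : nat.
Implicit Type T : {linear 'M[C]_n -> 'M[C]_m}.

(* T_k = id_k (x) T *)
Definition ampliation k T (A : 'M[C]_(k * n)) : 'M[C]_(k * m) :=
  flatten_mx (map_mx T (blocks_mx A)).

Lemma ampliation_tens k T (a : 'M[C]_k) (b : 'M[C]_n) :
  ampliation T (a *t b) = a *t T b.
Proof.
apply/matrixP => u v; rewrite !mxE.
set x := (X in T X); have -> : x = a (mxtens_unindex u).1 (mxtens_unindex v).1 *: b.
  by apply/matrixP => p q; rewrite !mxE !mxtens_indexK.
by rewrite linearZ mxE.
Qed.

Definition k_positive k T : Prop := positive_map (@ampliation k T).

Definition completely_positive T : Prop :=
  forall k : nat, (1 <= k)%N -> k_positive k T.

Definition J2 T : 'M[C]_(n * m) :=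
  \sum_(i < n) \sum_(j < n) delta_mx i j *t T (delta_mx i j).

End Definitions.

(* Main.v *)
(* Let w = sum_i e_i (x) e_i. Then J2 T = T_n (w w^* ), and w w^* is positive
   semidefinite, which gives one direction. Conversely, a positive semidefinite
   matrix is a sum of matrices x x^*; every vector x of C^k (x) C^n is
   (X (x) 1) w for a k x n matrix X, and T_k commutes with the action of X on
   the first factor, so T_k (x x^* ) = (X (x) 1) (J2 T) (X (x) 1)^*. *)
Require Import Defs.
From HB Require Import structures.
From mathcomp Require Import all_boot all_order all_algebra.
From mathcomp Require Import complex mxtens reals.

Set Implicit Arguments.
Unset Strict Implicit.
Unset Printing Implicit Defensive.

Import Order.TTheory GRing.Theory Num.Theory.
Local Open Scope ring_scope.
Local Open Scope sesquilinear_scope.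

Section AdjointMatrix.
Variable C : numClosedFieldType.

Lemma adjmxM p q r (A : 'M[C]_(p, q)) (B : 'M[C]_(q, r)) :
  (A *m B) ^t* = B ^t* *m A ^t*.
Proof. by rewrite trmx_mul map_mxM. Qed.

Lemma hermsymmxP p (A : 'M[C]_p) : reflect (A ^t* = A) (A \is hermsymmx).
Proof.
by apply: (iffP (is_hermitianmxP _ _ _)); rewrite expr0 scale1r => /esym.
Qed.

(** Reduces a Gram matrix to rank-one terms, which [ampliation], being additive, can treat one at a
    time. *)
Lemma mulmx_sum_col p q (A : 'M[C]_(p, q)) :
  A *m A ^t* = \sum_i col i A *m (col i A) ^t*.
Proof.
apply/matrixP => u v; rewrite summxE !mxE; apply: eq_bigr => i _.
by rewrite !mxE big_ord1 !mxE.
Qed.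

End AdjointMatrix.

Section PositiveSemidefinite.
Variable C : numClosedFieldType.

Lemma psdmx0 p : psdmx (0 : 'M[C]_p).
Proof.
split; first by apply/hermsymmxP; rewrite trmx0 map_mx0.
by move=> v; rewrite mulmx0 mul0mx mxE.
Qed.

Lemma psdmxD p (A B : 'M[C]_p) : psdmx A -> psdmx B -> psdmx (A + B).
Proof.
move=> [/hermsymmxP hA pA] [/hermsymmxP hB pB]; split.
  by apply/hermsymmxP; rewrite linearD /= map_mxD hA hB.
by move=> v; rewrite mulmxDr mulmxDl mxE addr_ge0.
Qed.

Lemma psdmx_sum p (I : finType) (A : I -> 'M[C]_p) :
  (forall i, psdmx (A i)) -> psdmx (\sum_i A i).
Proof.
move=> psdA; apply: (big_ind (@psdmx C p)) => //; first exact: psdmx0.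
exact: psdmxD.
Qed.

Lemma psdmx_congr p q (B : 'M[C]_(q, p)) (A : 'M[C]_p) :
  psdmx A -> psdmx (B *m A *m B ^t*).
Proof.
move=> [/hermsymmxP hA pA]; split.
  by apply/hermsymmxP; rewrite !adjmxM trmxCK hA mulmxA.
by move=> v; have := pA (B ^t* *m v); rewrite adjmxM trmxCK !mulmxA.
Qed.

Lemma psdmx1 p : psdmx (1%:M : 'M[C]_p).
Proof.
split; first exact: hermitian1mx_subproof.
move=> v; rewrite mulmx1 mxE sumr_ge0 // => i _.
by rewrite !mxE mulrC mul_conjC_ge0.
Qed.

Lemma psdmx_gram p q (B : 'M[C]_(p, q)) : psdmx (B *m B ^t*).
Proof. by have := psdmx_congr B (psdmx1 q); rewrite mulmx1. Qed.

(** By the spectral theorem [A] is P^* D P with P unitary and D diagonal. The entries of D are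
    nonnegative, so they have real square roots, and P^* sqrt(D) serves as [B]. *)
Lemma psdmx_sqrt p (A : 'M[C]_p) :
  psdmx A -> exists B : 'M[C]_p, A = B *m B ^t*.
Proof.
move=> psdA; have /hermitian_normalmx/orthomx_spectralP := psdA.1.
have uP := spectral_unitarymx A; set P := spectralmx A in uP *.
set d := spectral_diag A; rewrite invmx_unitary // => defA.
(* The eigenvalue [d 0 i] is the value of the quadratic form of P A P^* at the i-th basis vector. *)
have d_ge0 i : 0 <= d 0 i.
  have defd : P *m A *m P ^t* = diag_mx d.
    rewrite {1}defA !mulmxA (unitarymxP uP) mul1mx -mulmxA (unitarymxP uP).
    exact: mulmx1.
  have := (psdmx_congr P psdA).2 (delta_mx i 0).
  rewrite defd trmx_delta map_delta_mx -rowE -colE !mxE eqxx.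
  by rewrite mulr1n.
exists (P ^t* *m diag_mx (map_mx sqrtC d)).
rewrite adjmxM trmxCK mulmxA -(mulmxA (P ^t*)) {1}defA; congr (_ *m _ *m _).
apply/matrixP => i j; rewrite mul_diag_mx !mxE eq_sym.
case: eqP => [->|_]; last by rewrite !mulr0n conjC0 mulr0.
by rewrite !mulr1n conj_Creal ?ger0_real ?sqrtC_ge0 // -expr2 sqrtCK.
Qed.

End PositiveSemidefinite.

Section Ampliation.
Variables (C : numClosedFieldType) (n m : nat).
Variable T : {linear 'M[C]_n -> 'M[C]_m}.

Lemma ampliation_is_zmod_morphism k : zmod_morphism (@ampliation C n m k T).
Proof.
move=> A B; apply/matrixP => u v; rewrite !mxE.
set x := (X in T X _ _ = _); set y := (X in _ = T X _ _ - _).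
set z := (X in _ = _ - T X _ _).
(* Extracting a block is entrywise, so the blocks of [A - B] are differences of blocks. *)
have -> : x = y - z by apply/matrixP => p q; rewrite !mxE.
by rewrite linearB !mxE.
Qed.

HB.instance Definition _ k := GRing.isZmodMorphism.Build _ _
  (@ampliation C n m k T) (@ampliation_is_zmod_morphism k).

(* The number of columns is [1 * 1], convertible to [1], so that the Kronecker
   product lemmas apply. *)
Definition max_entangled : 'M[C]_(n * n, 1 * 1) :=
  \sum_(i < n) (delta_mx i 0 : 'cV_n) *t (delta_mx i 0 : 'cV_n).

Lemma max_entangled_proj : max_entangled *m max_entangled ^t* =
  \sum_(i < n) \sum_(j < n) delta_mx i j *t delta_mx i j.
Proof.
rewrite /max_entangled mulmx_suml; apply: eq_bigr => i _.
rewrite raddf_sum /= raddf_sum /= mulmx_sumr; apply: eq_bigr => j _.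
by rewrite trmx_tens map_mxT trmx_delta map_delta_mx tensmx_mul mul_delta_mx.
Qed.

Lemma ampliation_max_entangled :
  ampliation T (max_entangled *m max_entangled ^t*) = J2 T.
Proof.
rewrite max_entangled_proj raddf_sum; apply: eq_bigr => i _.
by rewrite raddf_sum; apply: eq_bigr => j _ /=; rewrite ampliation_tens.
Qed.

(** By additivity it suffices to compare the terms for each pair i, j: both equal (X E_ij Y) (x)
    T(E_ij), since [X] and [Y] touch only the first factor and [T] only the second. The identity
    factors have size n on the left and m on the right. *)
Lemma ampliation_J2 k (X : 'M[C]_(k, n)) (Y : 'M[C]_(n, k)) :
  ampliation T ((X *t 1%:M) *m (max_entangled *m max_entangled ^t*)
                *m (Y *t 1%:M)) =
  (X *t 1%:M) *m J2 T *m (Y *t 1%:M).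
Proof.
rewrite max_entangled_proj !mulmx_sumr !mulmx_suml raddf_sum.
apply: eq_bigr => i _; rewrite !mulmx_sumr !mulmx_suml raddf_sum.
apply: eq_bigr => j _.
by rewrite /= !tensmx_mul !mul1mx !mulmx1 ampliation_tens.
Qed.

Lemma vec_max_entangled k (x : 'M[C]_(k * n, 1 * 1)) :
  exists X : 'M[C]_(k, n), x = (X *t 1%:M) *m max_entangled.
Proof.
(* Since (X (x) 1) w = sum_i X e_i (x) e_i, the columns of X must be the slices of [x] along the
   second factor. *)
exists (\matrix_(a, i) x (mxtens_index (a, i)) 0).
rewrite /max_entangled mulmx_sumr; apply/matrixP => u v.
rewrite summxE (ord1 v).
rewrite -[u]mxtens_unindexK; case: (mxtens_unindex u) => a i.
rewrite (bigD1 i) //= big1 ?addr0 => [|j /negPf neq_ji].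
  by rewrite tensmx_mul -colE mul1mx !mxE !mxtens_indexK eqxx /= mulr1.
by rewrite tensmx_mul mul1mx !mxE !mxtens_indexK /= eq_sym neq_ji mulr0.
Qed.

Lemma ampliation_gram_psd k (x : 'cV[C]_(k * n)) :
  psdmx (J2 T) -> psdmx (ampliation T (x *m x ^t*)).
Proof.
have [X ->] := vec_max_entangled x => psdJ.
rewrite adjmxM mulmxA -(mulmxA (X *t _)).
(* Stated for every [q]: it is used with q = n before [ampliation_J2] and with q = m after it. *)
have adjX q : (X *t (1%:M : 'M[C]_q)) ^t* = X ^t* *t 1%:M.
  by rewrite trmx_tens map_mxT trmx1 map_mx1.
by rewrite adjX ampliation_J2 -adjX; apply: psdmx_congr.
Qed.

End Ampliation.

Theorem corollary2 (R : realType) (n m : nat)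
  (hn : (1 <= n)%N) (hm : (1 <= m)%N)
  (T : {linear 'M[R[i]]_n -> 'M[R[i]]_m}) :
  completely_positive T <-> psdmx (J2 T).
Proof.
split=> [cpT | psdJ k _ A /psdmx_sqrt[B ->]].
  (* Complete positivity is applied at level k = n, which [hn] allows. *)
  by rewrite -ampliation_max_entangled; apply: cpT => //; apply: psdmx_gram.
rewrite mulmx_sum_col raddf_sum; apply: psdmx_sum => i.
exact: ampliation_gram_psd.
Qed.
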